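(* Let $c\ge1$ and let $T$ be a labelled $c$-grid possessing symmetry (vertical, rotational and slide symmetry). If the four edge-ratio relationships are satisfied at every $(r,d)$ in the upper left half of the $c$-grid, then the four edge-ratio relationships are satisfied in the entire $c$-grid.
   Context: **Labelled grids.** For $c\ge 1$, a $c$-grid is the triangular graph made of $c$ rows of upright triangles: row $r$ ($1\le r\le c$, counted from the top) contains the upright triangles $T_{r,d}$, $1\le d\le r$, counted from the left. The edges of the graph are exactly the left, right and base edges of the upright triangles, and each edge belongs to exactly one upright triangle. A labelled $c$-grid $T$ is an arbitrary assignment of positive real labels (resistances) $T_{L,r,d},T_{R,r,d},T_{B,r,d}$ to the left, right and base edges of each $T_{r,d}$, $1\le d\le r\le c$. **Symmetries.** For all $1\le d\le r\le c$: *vertical symmetry*: $T_{L,r,d}=T_{R,r,r+1-d}$, $T_{B,r,d}=T_{B,r,r+1-d}$; *rotational symmetry*: $T_{L,r,d}=T_{R,c+d-r,c+1-r}$, $T_{R,r,d}=T_{B,c+d-r,c+1-r}$, $T_{B,r,d}=T_{L,c+d-r,c+1-r}$; *slide symmetry*: $T_{L,r,d}=T_{L,c+d-r,d}$, $T_{R,r,d}=T_{B,c+d-r,d}$. **Edge-ratio functions.** $$r_{R,L}(r,d)=\frac{2(r-d)+1}{2d-1},\qquad r_{B,L}(c,r,d)=\frac{2(c-r)+1}{2d-1},$$ $$x(c,r)=\frac{r-1}{2r-1}\cdot\frac{2(c-r)+3}{(c-r)+1},\qquad y(r,d)=\frac{d-1}{2d-3}\cdot\frac{2(r-d)+3}{(r-d)+1}.$$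 **The four edge-ratio relationships** at $(r,d)$, $1\le d\le r\le c$, are: vertical (only when $d=1$, $r\ge2$): $T_{L,r,1}=x(c,r)\,T_{L,r-1,1}$; horizontal (only when $d\ge2$): $T_{L,r,d}=y(r,d)\,T_{L,r,d-1}$; right-left: $T_{R,r,d}=r_{R,L}(r,d)\,T_{L,r,d}$; base-left: $T_{B,r,d}=r_{B,L}(c,r,d)\,T_{L,r,d}$. They are satisfied in the entire $c$-grid if they hold at all $(r,d)$ with $1\le d\le r\le c$. **Upper left half.** The upper left half of the $c$-grid consists of the triangles $T_{r,d}$ with $1\le d\le\lfloor\frac{c+2}{3}\rfloor$ and $2d-1\le r\le\lfloor\frac{c+d}{2}\rfloor$. *)

(* Defs.v *)
From mathcomp Require Import all_boot all_order all_algebra.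
From mathcomp Require Import reals.

Set Implicit Arguments.
Unset Strict Implicit.
Unset Printing Implicit Defensive.

Import Order.TTheory GRing.Theory Num.Theory.

Local Open Scope ring_scope.

(* Rows and positions are numbered from 1: (r, d) is the d-th upright triangle
   from the left in the r-th row from the top. *)
Definition in_grid (c r d : nat) : bool := [&& 1 <= d, d <= r & r <= c]%N.

(* Every edge of the grid is the left, right or base edge of exactly one upright
   triangle, so labelling the edges amounts to giving three labels for each
   triangle.  The values outside in_grid are junk and are never used. *)
Record labelled_grid (R : realType) (c : nat) := LabelledGrid {
  labL : nat -> nat -> R;
  labR : nat -> nat -> R;
  labB : nat -> nat -> R;
  labL_gt0 : forall r d : nat, in_grid c r d -> 0 < labL r d;
  labR_gt0 : forall r d : nat, in_grid c r d -> 0 < labR r d;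
  labB_gt0 : forall r d : nat, in_grid c r d -> 0 < labB r d
}.

(* On in_grid the truncated subtractions in the indices below are exact. *)
Definition vertical_symmetry (R : realType) (c : nat) (T : labelled_grid R c) :=
  forall r d : nat, in_grid c r d ->
    labL T r d = labR T r (r + 1 - d)%N /\
    labB T r d = labB T r (r + 1 - d)%N.

Definition rotational_symmetry (R : realType) (c : nat)
    (T : labelled_grid R c) :=
  forall r d : nat, in_grid c r d ->
    [/\ labL T r d = labR T (c + d - r)%N (c + 1 - r)%N,
        labR T r d = labB T (c + d - r)%N (c + 1 - r)%N
      & labB T r d = labL T (c + d - r)%N (c + 1 - r)%N].

Definition slide_symmetry (R : realType) (c : nat) (T : labelled_grid R c) :=
  forall r d : nat, in_grid c r d ->
    labL T r d = labL T (c + d - r)%N d /\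
    labR T r d = labB T (c + d - r)%N d.

Definition symmetric_grid (R : realType) (c : nat) (T : labelled_grid R c) :=
  [/\ vertical_symmetry T, rotational_symmetry T & slide_symmetry T].

(* The arguments are cast into R first, so that all subtractions are genuine. *)
Definition ratioRL (R : realType) (r d : nat) : R :=
  (2 * (r%:R - d%:R) + 1) / (2 * d%:R - 1).

Definition ratioBL (R : realType) (c r d : nat) : R :=
  (2 * (c%:R - r%:R) + 1) / (2 * d%:R - 1).

Definition ratioX (R : realType) (c r : nat) : R :=
  (r%:R - 1) / (2 * r%:R - 1) *
  ((2 * (c%:R - r%:R) + 3) / ((c%:R - r%:R) + 1)).

Definition ratioY (R : realType) (r d : nat) : R :=
  (d%:R - 1) / (2 * d%:R - 3) *
  ((2 * (r%:R - d%:R) + 3) / ((r%:R - d%:R) + 1)).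

Definition vertical_ratio (R : realType) (c : nat) (T : labelled_grid R c)
    (r d : nat) :=
  d = 1%N -> (2 <= r)%N -> labL T r 1 = ratioX R c r * labL T (r - 1)%N 1.

Definition horizontal_ratio (R : realType) (c : nat) (T : labelled_grid R c)
    (r d : nat) :=
  (2 <= d)%N -> labL T r d = ratioY R r d * labL T r (d - 1)%N.

Definition right_left_ratio (R : realType) (c : nat) (T : labelled_grid R c)
    (r d : nat) :=
  labR T r d = ratioRL R r d * labL T r d.

Definition base_left_ratio (R : realType) (c : nat) (T : labelled_grid R c)
    (r d : nat) :=
  labB T r d = ratioBL R c r d * labL T r d.

Definition edge_ratios_at (R : realType) (c : nat) (T : labelled_grid R c)
    (r d : nat) :=
  [/\ vertical_ratio T r d, horizontal_ratio T r d,
      right_left_ratio T r d & base_left_ratio T r d].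

Definition upper_left_half (c r d : nat) : bool :=
  [&& 1 <= d, d <= (c + 2) %/ 3, 2 * d - 1 <= r & r <= (c + d) %/ 2]%N.

(* Main.v *)
Require Import Defs.
From mathcomp Require Import all_boot all_order all_algebra.
From mathcomp Require Import reals.
From mathcomp Require Import zify ring lra.

(** Give the triangle T_(r,d) the coordinates p = d - 1, q = r - d, s = c - r, so
    that p + q + s + 1 = c.  The symmetries permute (p, q, s) and let every label
    be read off the left labels L(p, q, s).  The four relationships hold
    everywhere as soon as L(p, q, s) = K (2p + 1) w(p) w(q) w(s) for some K, with
    w(n) = prod_(1 <= i <= n) i / (2i + 1).  The upper left half is the
    fundamental domain p <= q <= s: there the formula follows by induction on q
    (vertical ratios, p = 0) and then on p (horizontal ratios), where a step that
    leaves the domain is brought back by the slide symmetry; the right-left and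
    base-left ratios then carry it to the other triangles of each orbit. *)

Set Implicit Arguments.
Unset Strict Implicit.
Unset Printing Implicit Defensive.

Import Order.TTheory GRing.Theory Num.Theory.

Local Open Scope ring_scope.

(** Equals n!/(2n+1)!!, the product whose successive quotients are the factors occurring in [ratioX]
    and [ratioY]. *)
Definition weight (R : realType) (n : nat) : R :=
  \prod_(i < n) (i.+1%:R / (2 * i%:R + 3)).

Lemma weightS (R : realType) (n : nat) :
  weight R n.+1 = weight R n * ((n%:R + 1) / (2 * n%:R + 3)).
Proof. by rewrite /weight big_ord_recr /= natr1. Qed.

Definition model (R : realType) (p q s : nat) : R :=
  (2 * p%:R + 1) * (weight R p * weight R q * weight R s).

Section Coordinates.
Variables (R : realType) (c : nat) (T : labelled_grid R c).

(** The slide swaps q and s; the reflection swaps p and q and turns right edges into left ones. A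
    base edge is slid to a right edge, then reflected. *)
Lemma sym_coord (p q s : nat) : symmetric_grid T -> (p + q + s).+1 = c ->
  [/\ labL T (p + q).+1 p.+1 = labL T (p + s).+1 p.+1,
      labR T (p + q).+1 p.+1 = labL T (p + q).+1 q.+1
    & labB T (p + q).+1 p.+1 = labL T (p + s).+1 s.+1].
Proof.
move=> [hv _ hs] hc.
have right_left x y z : (x + y + z).+1 = c ->
    labR T (x + y).+1 x.+1 = labL T (x + y).+1 y.+1.
  move=> h; have hg : in_grid c (x + y).+1 y.+1 by rewrite /in_grid; lia.
  have [-> _] := hv _ _ hg.
  by have -> : ((x + y).+1 + 1 - y.+1 = x.+1)%N by lia.
have hg1 : in_grid c (p + q).+1 p.+1 by rewrite /in_grid; lia.
have hg2 : in_grid c (p + s).+1 p.+1 by rewrite /in_grid; lia.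
have e1 : (c + p.+1 - (p + q).+1 = (p + s).+1)%N by lia.
have e2 : (c + p.+1 - (p + s).+1 = (p + q).+1)%N by lia.
have [hL _] := hs _ _ hg1; have [_ hB] := hs _ _ hg2.
rewrite e1 in hL; rewrite e2 in hB.
split; [exact: hL | exact: right_left hc | rewrite -hB].
by apply: (right_left p s q); lia.
Qed.

Lemma natr_coord (p q s : nat) : (p + q + s).+1 = c ->
  [/\ (p + q).+1%:R - p.+1%:R = q%:R :> R,
      c%:R - (p + q).+1%:R = s%:R :> R & p.+1%:R = p%:R + 1 :> R].
Proof. by move=> <-; split; ring. Qed.

(** Each ratio is a quotient of two [model] values: [ratioX] moves a unit from s to q, [ratioY] one
    from q to p, and the other two permute the coordinates, which changes only the factor 2p + 1. *)
Lemma model_edge_ratios (K : R) :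
    symmetric_grid T ->
    (forall p q s : nat, (p + q + s).+1 = c ->
       labL T (p + q).+1 p.+1 = K * model R p q s) ->
  forall r d : nat, in_grid c r d -> edge_ratios_at T r d.
Proof.
move=> hsym hL r d /and3P[d1 dr rc].
have [p [q [s [-> -> hc]]]] :
    exists p q s, [/\ r = (p + q).+1, d = p.+1 & (p + q + s).+1 = c].
  by exists (d - 1)%N, (r - d)%N, (c - r)%N; split; lia.
have [_ hR hB] := sym_coord hsym hc.
have [eq es ep] := natr_coord hc.
have pos n : 0 <= n%:R :> R by exact: ler0n.
split.
- move=> [p0]; subst p.
  case: q hc eq es hR hB => [//|q] hc eq es _ _ _.
  have -> : ((0 + q.+1).+1 - 1 = (0 + q).+1)%N by lia.
  rewrite (hL _ _ s hc) (hL 0%N q s.+1); last by lia.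
  rewrite /ratioX es /model !weightS !add0n.
  by have := (pos q, pos s) => -[hq hs]; field; rewrite !lt0r_neq0 //; lra.
- case: p hc eq es ep hR hB => [//|p] hc eq _ ep _ _ _.
  have -> : (p.+2 - 1 = p.+1)%N by lia.
  rewrite (hL _ _ s hc).
  have -> : (p.+1 + q).+1 = (p + q.+1).+1 by lia.
  rewrite (hL p q.+1 s); last by lia.
  rewrite /ratioY -addSnnS eq ep /model !weightS.
  by have := (pos q, pos p) => -[hq hp]; field; rewrite !lt0r_neq0 //; lra.
- rewrite /right_left_ratio hR [in LHS]addnC (hL q p s) ?(hL p q s) //; last by lia.
  by rewrite /ratioRL eq ep /model; have := pos p => hp; field; rewrite !lt0r_neq0 //; lra.
- rewrite /base_left_ratio hB [in LHS]addnC (hL s p q) ?(hL p q s) //; last by lia.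
  by rewrite /ratioBL es ep /model; have := pos p => hp; field; rewrite !lt0r_neq0 //; lra.
Qed.

Hypothesis hsym : symmetric_grid T.
Hypothesis hupper : forall r d, upper_left_half c r d -> edge_ratios_at T r d.

Lemma upper_coord (p q s : nat) : (p + q + s).+1 = c -> (p <= q <= s)%N ->
  edge_ratios_at T (p + q).+1 p.+1.
Proof. by move=> hc hpqs; apply: hupper; rewrite /upper_left_half; lia. Qed.

Lemma model_min_left (K : R) :
    (forall s, s.+1 = c -> labL T 1 1 = K * model R 0 0 s) ->
  forall p q s : nat, (p + q + s).+1 = c -> (p <= q)%N -> (p <= s)%N ->
    labL T (p + q).+1 p.+1 = K * model R p q s.
Proof.
move=> hK.
have slide p q s : (p + q + s).+1 = c ->
    labL T (p + s).+1 p.+1 = K * model R p s q ->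
    labL T (p + q).+1 p.+1 = K * model R p q s.
  by move=> hc; have [-> _ _] := sym_coord hsym hc; move=> ->; rewrite /model; ring.
have pos n : 0 <= n%:R :> R by exact: ler0n.
elim=> [|p IHp] q s hc pq ps.
- wlog qs : q s hc {pq ps} / (q <= s)%N.
    move=> H; have [|sq] := leqP q s; first exact: H.
    by apply: slide => //; apply: H; lia.
  elim: q s hc qs => [|q IHq] s hc qs; first exact: hK.
  have [|hv _ _ _] := upper_coord hc; first by lia.
  have [_ es _] := natr_coord hc.
  have {hv} := hv erefl isT.
  have -> : ((0 + q.+1).+1 - 1 = (0 + q).+1)%N by lia.
  (* The triangle above has coordinates (0, q, s + 1), still with q <= s + 1. *)
  rewrite (IHq s.+1) => [->||]; try lia.
  rewrite /ratioX es /model !weightS !add0n.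
  by have := (pos q, pos s) => -[hq hs]; field; rewrite !lt0r_neq0 //; lra.
- wlog qs : q s hc pq ps / (q <= s)%N.
    move=> H; have [|sq] := leqP q s; first exact: H.
    by apply: slide => //; apply: H; lia.
  have [|_ hh _ _] := upper_coord hc; first by lia.
  have [eq _ ep] := natr_coord hc.
  have {hh} := hh isT.
  have -> : (p.+2 - 1 = p.+1)%N by lia.
  have e : (p.+1 + q).+1 = (p + q.+1).+1 by lia.
  (* The left neighbour is (p, q + 1, s). Possibly q + 1 > s, which is why the induction on p covers
     both orders of q and s. *)
  rewrite {3}e (IHp q.+1 s) => [->|||]; try lia.
  rewrite /ratioY eq ep /model !weightS.
  by have := (pos q, pos p) => -[hq hp]; field; rewrite !lt0r_neq0 //; lra.
Qed.

Lemma model_left (K : R) :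
    (forall s, s.+1 = c -> labL T 1 1 = K * model R 0 0 s) ->
  forall p q s : nat, (p + q + s).+1 = c ->
    labL T (p + q).+1 p.+1 = K * model R p q s.
Proof.
move=> hK p q s hc.
wlog qs : q s hc / (q <= s)%N.
  move=> H; have [|sq] := leqP q s; first exact: H.
  have [-> _ _] := sym_coord hsym hc.
  by rewrite (H s q); [rewrite /model; ring | lia | lia].
have [pq|qp] := leqP p q; first by apply: (model_min_left hK) => //; lia.
have hq : 0 <= q%:R :> R by exact: ler0n.
(* Now q is the least coordinate. If p is the middle one, the label is the right edge of (q, p, s);
   if p is the largest, it is the base edge of (q, s, p). Both triangles lie in the upper left
   half. *)
have [ps|sp] := leqP p s.
- have hc' : (q + p + s).+1 = c by lia.
  have [_ hR _] := sym_coord hsym hc'.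
  have [|_ _ hr _] := upper_coord hc'; first by lia.
  have [eq _ ep] := natr_coord hc'.
  rewrite addnC -hR hr (model_min_left hK hc'); try lia.
  by rewrite /ratioRL eq ep /model; field; rewrite !lt0r_neq0 //; lra.
- have hc' : (q + s + p).+1 = c by lia.
  have [_ _ hB] := sym_coord hsym hc'.
  have [|_ _ _ hb] := upper_coord hc'; first by lia.
  have [_ es ep] := natr_coord hc'.
  rewrite addnC -hB hb (model_min_left hK hc'); try lia.
  by rewrite /ratioBL es ep /model; field; rewrite !lt0r_neq0 //; lra.
Qed.

End Coordinates.

Lemma weight_neq0 (R : realType) (n : nat) : weight R n != 0.
Proof.
apply/prodf_neq0 => i _; rewrite mulf_neq0 ?pnatr_eq0 // invr_eq0.
by have := ler0n R i => hi; lra.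
Qed.

Theorem theorem6 (R : realType) (c : nat) (hc : (1 <= c)%N)
    (T : labelled_grid R c) (hsym : symmetric_grid T)
    (hupper : forall r d : nat, upper_left_half c r d -> edge_ratios_at T r d) :
  forall r d : nat, in_grid c r d -> edge_ratios_at T r d.
Proof.
(* Normalised at the apex, where p = q = 0 and s = c - 1. *)
pose K := labL T 1 1 / model R 0 0 (c - 1).
have hK s : s.+1 = c -> labL T 1 1 = K * model R 0 0 s.
  move=> e; rewrite /K; have -> : (c - 1 = s)%N by lia.
  rewrite divfK // /model mulr0 add0r mul1r.
  by rewrite !mulf_neq0 ?weight_neq0.
exact: model_edge_ratios hsym (model_left hsym hupper hK).
Qed.
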